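(* Let $G$ and $H$ be connected, singularly cospectral graphs whose largest singular value has multiplicity at least $2$. Then $G$ and $H$ are almost cospectral.
   Context: All graphs are finite and simple. The singular values of a graph are the singular values of its adjacency matrix (equivalently the absolute values of its eigenvalues, counted with multiplicity). Two graphs are singularly cospectral if they have the same nonzero singular values with the same multiplicities. Two graphs are almost cospectral if their nonzero adjacency eigenvalues, with multiplicities, coincide. *)

(* Defs.v *)
From HB Require Import structures.
From mathcomp Require Import all_boot all_order all_algebra.

Set Implicit Arguments.
Unset Strict Implicit.
Unset Printing Implicit Defensive.

Import Order.TTheory GRing.Theory Num.Theory.

Local Open Scope ring_scope.

Record sgraph := SGraph {
  vertex :> finType;
  adj : rel vertex;
  adj_sym : symmetric adj;
  adj_irrefl : irreflexive adj
}.

(* The graph with no vertices is not considered connected. *)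
Definition connected_graph (G : sgraph) : Prop :=
  (0 < #|G|)%N /\ forall x y : G, connect (@adj G) x y.

Definition adjmx (R : nzRingType) (G : sgraph) : 'M[R]_#|G| :=
  \matrix_(i, j) (adj (enum_val i) (enum_val j))%:R.

Definition eig_mult (R : fieldType) (n : nat) (A : 'M[R]_n) (a : R) : nat :=
  mup a (char_poly A).

(* The singular values of A are the nonnegative square roots of the
   eigenvalues of A^T A; a value that is not singular has multiplicity 0. *)
Definition sing_mult (R : rcfType) (n : nat) (A : 'M[R]_n) (s : R) : nat :=
  if 0 <= s then eig_mult (A^T *m A) (s ^+ 2) else 0%N.

Definition singular_value (R : rcfType) (n : nat) (A : 'M[R]_n) (s : R) : Prop :=
  (0 < sing_mult A s)%N.

Definition largest_singular_value (R : rcfType) (n : nat) (A : 'M[R]_n)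
    (s : R) : Prop :=
  singular_value A s /\ forall t : R, singular_value A t -> t <= s.

Definition singularly_cospectral (R : rcfType) (G H : sgraph) : Prop :=
  forall s : R, s != 0 -> sing_mult (adjmx R G) s = sing_mult (adjmx R H) s.

Definition almost_cospectral (R : rcfType) (G H : sgraph) : Prop :=
  forall a : R, a != 0 -> eig_mult (adjmx R G) a = eig_mult (adjmx R H) a.

(* Main.v *)
Require Import Defs.
From HB Require Import structures.
From mathcomp Require Import all_boot all_order all_algebra reals.
From mathcomp Require Import complex spectral.

(** Let s be the largest singular value of a connected graph, with adjacency
    matrix A, and suppose it is multiple. The spectral theorem gives the bound
    |y A| <= s |y| for all y, and an eigenspace of A^2 for s^2 of dimension at
    least 2. If x is an eigenvector of A for s or -s, then |x| A >= s |x|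
    entrywise, so by the bound |x| is an eigenvector for s, and by connectedness
    x has no zero entry. A 2-dimensional space contains a nonzero vector with a
    zero entry, so A is not s on the whole eigenspace, and A therefore has an
    eigenvector for -s. Its signs 2-colour the graph. The spectrum of
    a bipartite graph is symmetric about 0, so each eigenvalue a <> 0 has half
    the multiplicity of the singular value |a|. *)

Set Implicit Arguments.
Unset Strict Implicit.
Unset Printing Implicit Defensive.

Import Order.TTheory GRing.Theory Num.Theory.

Local Open Scope ring_scope.

(** * Multiplicities *)

Lemma mup_eq (F : fieldType) (p : {poly F}) (a : F) (m : nat) (r : {poly F}) :
  ~~ root r a -> p = ('X - a%:P) ^+ m * r -> mup a p = m.
Proof. by move=> ra ->; rewrite mupMl // mup_XsubCX eqxx. Qed.

(** [X^2 - a^2] splits as [(X - a)(X + a)], and [2a != 0] keeps [X + a] nonzero at [a], so each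
    factor of [p] at [a^2] contributes exactly one at [a]. *)
Lemma mup_comp_sqr (F : fieldType) (p : {poly F}) (a : F) :
  p != 0 -> 2%:R * a != 0 -> mup a (p \Po 'X^2) = mup (a ^+ 2) p.
Proof.
move=> p0 a0; have [m [r]] := multiplicity_XsubC p (a ^+ 2).
rewrite p0 /= => ra pE; rewrite [RHS](mup_eq ra (m := m)) 1?mulrC //.
apply: (@mup_eq _ _ _ _ (('X + a%:P) ^+ m * (r \Po 'X^2))).
  rewrite rootM negb_or /root horner_comp !hornerE ra andbT.
  by rewrite expf_neq0 // -mulr2n -mulr_natl.
rewrite pE comp_polyM rmorphXn /= rmorphB /= comp_polyX comp_polyC.
by rewrite polyC_exp subr_sqr exprMn [LHS]mulrC mulrA.
Qed.

Lemma mup_comp_opp (F : fieldType) (p : {poly F}) (a : F) :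
  p != 0 -> mup a (p \Po - 'X) = mup (- a) p.
Proof.
move=> p0; have [m [r]] := multiplicity_XsubC p (- a).
rewrite p0 /= => ra pE; rewrite [RHS](mup_eq ra (m := m)) 1?mulrC //.
apply: (@mup_eq _ _ _ _ ((-1) ^+ m * (r \Po - 'X))).
  rewrite rootM negb_or /root horner_comp !hornerE ra andbT.
  by rewrite ?horner_exp ?hornerE expf_neq0 // oppr_eq0 oner_eq0.
rewrite pE comp_polyM rmorphXn /= rmorphB /= comp_polyX comp_polyC.
rewrite polyCN opprK mulrC mulrA -exprMn; congr (_ ^+ _ * _).
by rewrite mulrN1 opprB addrC.
Qed.

Lemma char_poly_neq0 (F : fieldType) n (A : 'M[F]_n) : char_poly A != 0.
Proof. exact/monic_neq0/char_poly_monic. Qed.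

Lemma char_poly_opp (F : fieldType) n (A : 'M[F]_n) :
  char_poly (- A) = (-1) ^+ n * (char_poly A \Po - 'X).
Proof.
rewrite /char_poly -[_ \Po _]/(comp_poly (- 'X) _) -det_map_mx -detZ; congr (\det _).
apply/matrixP=> i j; rewrite !mxE rmorphB /= comp_polyC rmorphMn /= comp_polyX.
by rewrite polyCN mulN1r opprB opprK mulNrn opprK addrC.
Qed.

Lemma eig_mult_opp (F : fieldType) n (A : 'M[F]_n) a :
  eig_mult (- A) a = eig_mult A (- a).
Proof.
rewrite /eig_mult char_poly_opp mupMr ?mup_comp_opp ?char_poly_neq0 //.
by rewrite /root horner_exp !hornerE expf_neq0 // oppr_eq0 oner_eq0.
Qed.

(* [det (X^2 - A^2) = det (X - A) det (X + A)] *)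
Lemma char_poly_sqr_comp (F : fieldType) n (A : 'M[F]_n) :
  char_poly (A *m A) \Po 'X^2 = char_poly A * char_poly (- A).
Proof.
rewrite /char_poly -[_ \Po _]/(comp_poly ('X^2) _) -det_map_mx -det_mulmx.
congr (\det _); rewrite /char_poly_mx map_mxN opprK mulmxBl !mulmxDr.
rewrite -scalar_mxM scalar_mxC opprD addrA addrK -map_mxM.
apply/matrixP=> i j; rewrite !mxE rmorphB /= comp_polyC rmorphMn /= comp_polyX.
by rewrite expr2.
Qed.

Lemma eig_mult_sqr (F : fieldType) n (A : 'M[F]_n) a : 2%:R * a != 0 ->
  eig_mult (A *m A) (a ^+ 2) = (eig_mult A a + eig_mult A (- a))%N.
Proof.
move=> a0; rewrite {1}/eig_mult -mup_comp_sqr ?char_poly_neq0 //.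
by rewrite char_poly_sqr_comp mupM ?char_poly_neq0 // -eig_mult_opp.
Qed.

(** The intertwining relation passes to the characteristic matrices; on taking determinants, the
    nonzero constant [\det P] cancels. *)
Lemma char_poly_conj (F : fieldType) n (P A B : 'M[F]_n) :
  P \in unitmx -> P *m A = B *m P -> char_poly A = char_poly B.
Proof.
move=> Pu PA.
have E : map_mx polyC P *m char_poly_mx A = char_poly_mx B *m map_mx polyC P.
  by rewrite /char_poly_mx mulmxBr mulmxBl scalar_mxC -!map_mxM PA.
have : \det (map_mx polyC P) != 0.
  by rewrite det_map_mx polyC_eq0 -unitfE -unitmxE.
by move=> /mulfI; apply; rewrite -det_mulmx E det_mulmx mulrC.
Qed.

(** * Real symmetric matrices *)

Section RealSymmetric.

Local Open Scope sesquilinear_scope.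

Variables (R : rcfType) (n : nat) (B : 'M[R]_n).
Hypothesis Bsym : B^T = B.

Local Notation toC := (real_complex R).

(** Over [R[i]] the matrix [B] is Hermitian, hence unitarily diagonalizable with real eigenvalues.
    Only the eigenvalues descend to [R]; the matrix [P] stays complex. *)
Lemma symmetric_spectral : exists (P : 'M[R[i]]_n) (d : 'rV[R]_n),
  P \is unitarymx /\ P *m map_mx toC B = diag_mx (map_mx toC d) *m P.
Proof.
have Bherm : map_mx toC B \is hermsymmx.
  apply: realsym_hermsym.
    by apply/is_hermitianmxP; rewrite expr0 scale1r map_mx_id // map_trmx Bsym.
  by apply/mxOverP=> i j; rewrite mxE; apply/complex_realP; exists (B i j).
have dreal := hermitian_spectral_diag_real Bherm.
have /orthomx_spectralP BE := hermitian_normalmx Bherm.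
exists (spectralmx (map_mx toC B)).
exists (map_mx (@complex.Re R) (spectral_diag (map_mx toC B))).
split; first exact: spectral_unitarymx.
rewrite {2}BE !mulmxA mulmxV ?spectral_unit // mul1mx; congr (diag_mx _ *m _).
by apply/rowP=> i; rewrite !mxE RRe_real //; apply/mxOverP.
Qed.

Lemma char_poly_spectral (P : 'M[R[i]]_n) (d : 'rV[R]_n) : P \is unitarymx ->
  P *m map_mx toC B = diag_mx (map_mx toC d) *m P ->
  char_poly B = \prod_i ('X - (d 0 i)%:P).
Proof.
move=> Pu PB; apply: (map_poly_inj (real_complex R)).
rewrite map_char_poly (char_poly_conj (unitarymx_unit Pu) PB).
rewrite char_poly_trig ?diag_mx_is_trig // rmorph_prod /=.
by apply: eq_bigr => i _; rewrite rmorphB /= map_polyX map_polyC !mxE eqxx.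
Qed.

Lemma rayleigh_le (m : R) (y : 'rV[R]_n) :
  (forall t, root (char_poly B) t -> t <= m) ->
  (y *m B *m y^T) 0 0 <= m * (y *m y^T) 0 0.
Proof.
move=> mP; have [P [d [Pu PB]]] := symmetric_spectral.
have dm i : d 0 i <= m.
  apply: mP; rewrite (char_poly_spectral Pu PB) (bigD1 i) //= rootM.
  by rewrite root_XsubC eqxx.
have yC : (map_mx toC y)^T = (map_mx toC y)^t*.
  by rewrite realmxC //; apply/mxOverP=> i j; rewrite !mxE; apply/complex_realP;
     exists (y j i).
(* The coordinates of [y] in the orthonormal eigenbasis formed by the rows of [P]. In them the two
   sides become [\sum_i d_i |w_i|^2] and [m \sum_i |w_i|^2]. *)
pose w := map_mx toC y *m P^t*.
have PtP : P^t* *m P = 1%:M by rewrite -invmx_unitary // mulVmx // unitarymx_unit.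
have wP : w *m P = map_mx toC y by rewrite /w -mulmxA PtP mulmx1.
have wt : P *m (map_mx toC y)^T = w^t*.
  by rewrite yC /w trmx_mul map_mxM /= trmxCK.
have E1 : toC ((y *m y^T) 0 0) = \sum_i `|w 0 i| ^+ 2.
  have -> : toC ((y *m y^T) 0 0) = (map_mx toC (y *m y^T)) 0 0 by rewrite [RHS]mxE.
  rewrite map_mxM -map_trmx -{1}wP -mulmxA wt mxE.
  by apply: eq_bigr => i _; rewrite !mxE normCK.
have E2 : toC ((y *m B *m y^T) 0 0) = \sum_i toC (d 0 i) * `|w 0 i| ^+ 2.
  have -> : toC ((y *m B *m y^T) 0 0) = (map_mx toC (y *m B *m y^T)) 0 0.
    by rewrite [RHS]mxE.
  rewrite !map_mxM -map_trmx -{1}wP -[w *m P *m _]mulmxA PB !mulmxA -mulmxA wt mxE.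
  by apply: eq_bigr => i _; rewrite mul_mx_diag !mxE normCK mulrAC mulrC mulrA.
rewrite -lecR rmorphM /= E1 E2 mulr_sumr; apply: ler_sum => i _.
by rewrite ler_wpM2r ?exprn_ge0 // lecR.
Qed.

(** The rows of [P] with eigenvalue [a] are orthonormal eigenvectors, as many as the multiplicity of
    [a]. They are complex, but the rank of a kernel does not change under field extension. *)
Lemma eig_mult_eigenspace (a : R) :
  (eig_mult B a <= \rank (eigenspace B a))%N.
Proof.
have [P [d [Pu PB]]] := symmetric_spectral.
pose S := [set i | d 0 i == a]; pose Q := rowsub (@enum_val _ (mem S)) P.
have -> : eig_mult B a = #|S|.
  rewrite /eig_mult (char_poly_spectral Pu PB).
  rewrite -(big_map (fun i => d 0 i) xpredT (fun y => 'X - y%:P)) mu_prod_XsubC.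
  rewrite count_map cardE /enum_mem size_filter -enumT enumT.
  by apply: eq_count => i /=; rewrite !inE.
have Qu : Q \is unitarymx.
  apply/unitarymxP/matrixP=> i j.
  have /unitarymxP/matrixP/(_ (enum_val i) (enum_val j)) := Pu.
  rewrite !mxE (inj_eq enum_val_inj) => <-.
  by apply: eq_bigr => k _; rewrite !mxE.
rewrite -(mxrank_unitary Qu) -(mxrank_map (real_complex R)) mxrankS //.
rewrite map_kermx; apply/sub_kermxP.
rewrite rmorphB /= map_scalar_mx mulmxBr mul_mx_scalar; apply/eqP.
rewrite subr_eq0; apply/eqP/row_matrixP=> i.
rewrite row_mul row_rowsub -row_mul PB mul_diag_mx.
apply/rowP=> k; rewrite !mxE; congr (toC _ * _); apply/eqP.
by have := enum_valP i; rewrite inE.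
Qed.

End RealSymmetric.

(** * The largest singular value *)

Lemma dot_rowE (R : pzRingType) n (y : 'rV[R]_n) :
  (y *m y^T) 0 0 = \sum_i y 0 i ^+ 2.
Proof. by rewrite mxE; apply: eq_bigr => i _; rewrite mxE expr2. Qed.

Lemma dot_row_ge0 (R : realDomainType) n (y : 'rV[R]_n) : 0 <= (y *m y^T) 0 0.
Proof. by rewrite dot_rowE sumr_ge0 // => i _; rewrite sqr_ge0. Qed.

Lemma dot_row_gt0 (R : realDomainType) n (y : 'rV[R]_n) :
  y != 0 -> 0 < (y *m y^T) 0 0.
Proof.
move=> /rV0Pn[i yi]; rewrite dot_rowE (bigD1 i) //= ltr_pwDl //.
  by rewrite exprn_even_gt0.
by rewrite sumr_ge0 // => j _; rewrite sqr_ge0.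
Qed.

Lemma gram_sym (R : comPzRingType) n (A : 'M[R]_n) : (A^T *m A)^T = A^T *m A.
Proof. by rewrite trmx_mul trmxK. Qed.

(** An eigenvector [v] for [t] satisfies [t |v|^2 = |v A^T|^2]. *)
Lemma gram_root_ge0 (R : rcfType) n (A : 'M[R]_n) (t : R) :
  root (char_poly (A^T *m A)) t -> 0 <= t.
Proof.
rewrite -eigenvalue_root_char => /eigenvalueP[v vA v0].
rewrite -(pmulr_lge0 _ (dot_row_gt0 v0)).
have -> : t * (v *m v^T) 0 0 = (v *m A^T *m (v *m A^T)^T) 0 0.
  by rewrite trmx_mul trmxK !mulmxA -[v *m _ *m A]mulmxA vA -scalemxAl [RHS]mxE.
exact: dot_row_ge0.
Qed.

Lemma largest_singular_value_ge0 (R : rcfType) n (A : 'M[R]_n) s :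
  largest_singular_value A s -> 0 <= s.
Proof. by case=> + _; rewrite /singular_value /sing_mult; case: ifP. Qed.

(** This is the Rayleigh bound for [A^T A]: each of its eigenvalues [t] is nonnegative and [sqrt t]
    is a singular value, so [t <= s^2]. *)
Lemma largest_singular_value_le (R : rcfType) n (A : 'M[R]_n) s (y : 'rV[R]_n) :
  largest_singular_value A s ->
  (y *m A^T *m (y *m A^T)^T) 0 0 <= s ^+ 2 * (y *m y^T) 0 0.
Proof.
move=> sP; have s0 := largest_singular_value_ge0 sP.
rewrite trmx_mul trmxK !mulmxA -[y *m _ *m A]mulmxA.
apply: (rayleigh_le (gram_sym A)) => t rt; have t0 := gram_root_ge0 rt.
rewrite -(sqr_sqrtr t0) lerXn2r ?nnegrE ?sqrtr_ge0 //; apply: sP.2.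
rewrite /singular_value /sing_mult sqrtr_ge0 sqr_sqrtr // /eig_mult.
by rewrite -XsubC_dvd ?char_poly_neq0 // dvdp_XsubCl.
Qed.

(** * Nonnegative symmetric matrices *)

(* [|x| A >= s |x|] entrywise, and the norm bound forces equality. *)
Lemma norm_eigenvector (R : realDomainType) n (A : 'M[R]_n) (s c : R) (x : 'rV[R]_n) :
  (forall i j, 0 <= A i j) -> 0 <= s ->
  (forall y : 'rV[R]_n, (y *m A *m (y *m A)^T) 0 0 <= s ^+ 2 * (y *m y^T) 0 0) ->
  `|c| = s -> x *m A = c *: x ->
  map_mx Num.norm x *m A = s *: map_mx Num.norm x.
Proof.
move=> A0 s0 bnd cs xA; set y := map_mx _ x.
have ge j : 0 <= s * y 0 j <= (y *m A) 0 j.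
  have := congr1 (fun z : 'rV_n => `|z 0 j|) xA.
  rewrite !mxE normrM cs mulr_ge0 //= => <-.
  apply: (le_trans (ler_norm_sum _ _ _)); apply: ler_sum => i _.
  by rewrite !mxE normrM (ger0_norm (A0 _ _)).
have ge2 j : 0 <= (y *m A) 0 j ^+ 2 - (s * y 0 j) ^+ 2.
  have /andP[h1 h2] := ge j.
  by rewrite subr_ge0 lerXn2r ?nnegrE // (le_trans h1).
have : \sum_j ((y *m A) 0 j ^+ 2 - (s * y 0 j) ^+ 2) == 0.
  rewrite eq_le sumr_ge0 // andbT big_split /= sumrN subr_le0.
  have := bnd y; rewrite !dot_rowE mulr_sumr.
  by under [X in _ <= X -> _]eq_bigr do rewrite -exprMn.
rewrite psumr_eq0 // => /allP E; apply/rowP=> j.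
have /andP[h1 h2] := ge j.
have /= := E j (mem_index_enum _); rewrite subr_eq0 eqrXn2 ?(le_trans h1) //.
by move=> /eqP->; rewrite [RHS]mxE.
Qed.

(** * Adjacency matrices *)

Section AdjacencyMatrix.

Variables (R : rcfType) (G : sgraph).
Local Notation A := (adjmx R G).

Lemma adjmx_tr : A^T = A.
Proof. by apply/matrixP=> i j; rewrite !mxE adj_sym. Qed.

Lemma adjmx_ge0 i j : 0 <= A i j.
Proof. by rewrite mxE ler0n. Qed.

Lemma sing_mult_adjmx (a : R) : a != 0 ->
  sing_mult A `|a| = (eig_mult A a + eig_mult A (- a))%N.
Proof.
move=> a0; rewrite /sing_mult normr_ge0 adjmx_tr real_normK ?num_real //.
by rewrite eig_mult_sqr // mulf_neq0 // pnatr_eq0.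
Qed.

Lemma connected_ind (P : G -> Prop) x : connected_graph G ->
  (forall u v, adj u v -> P u -> P v) -> P x -> forall y, P y.
Proof.
move=> [_ conG] step Px y; have /connectP[p] := conG x y.
elim: p x Px => [|z p IH] x Px /=; first by move=> _ ->.
by move=> /andP[xz zp]; apply: IH zp; apply: step xz Px.
Qed.

(** Zeros spread along edges: where [y] vanishes, its entries at the neighbours are nonnegative with
    sum 0, so they vanish too. *)
Lemma nonneg_eigenvector_eq0 (s : R) (y : 'rV[R]_#|G|) k : connected_graph G ->
  (forall i, 0 <= y 0 i) -> y *m A = s *: y -> y 0 k = 0 -> y = 0.
Proof.
move=> conG y0 yA yk; apply/rowP=> l; rewrite mxE -[l]enum_valK.
apply: (@connected_ind (fun v => y 0 (enum_rank v) = 0) (enum_val k)) => //.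
  move=> u v uv yu; have := congr1 (fun z : 'rV_#|G| => z 0 (enum_rank u)) yA.
  rewrite !mxE yu mulr0 => /eqP; rewrite psumr_eq0; last first.
    by move=> j _; rewrite mulr_ge0 ?adjmx_ge0.
  move=> /allP/(_ (enum_rank v) (mem_index_enum _)).
  by rewrite mxE !enum_rankK adj_sym uv mulr1 => /eqP.
by rewrite enum_valK.
Qed.

Definition bipartite := exists c : G -> bool, forall u v, adj u v -> c u != c v.

Lemma bipartite_eig_mult (a : R) : bipartite ->
  eig_mult A (- a) = eig_mult A a.
Proof.
move=> [c cP]; rewrite -eig_mult_opp /eig_mult.
(* Conjugation by the diagonal matrix of colour signs flips the sign of every entry of [A], since
   edges join opposite colours. *)
pose D : 'M[R]_#|G| := diag_mx (\row_i (-1) ^+ c (enum_val i)).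
have Du : D \in unitmx.
  rewrite unitmxE det_diag unitfE; apply/prodf_neq0 => i _.
  by rewrite mxE signr_eq0.
rewrite (char_poly_conj Du (B := A)) //.
apply/matrixP=> i j; rewrite mul_diag_mx mul_mx_diag !mxE.
have [uv|_] := boolP (adj _ _); last by rewrite oppr0 mulr0 mul0r.
have := cP _ _ uv; rewrite mul1r mulrN1.
by case: (c _); case: (c _) => //= _; rewrite ?opprK.
Qed.

(** By connectedness [|w|] has no zero entry, so the sign of [w] is defined at every vertex; it is
    the colouring. *)
Lemma bipartite_of_opp_eigenvector (s : R) (w : 'rV[R]_#|G|) :
  connected_graph G -> w != 0 -> w *m A = - s *: w ->
  map_mx Num.norm w *m A = s *: map_mx Num.norm w -> bipartite.
Proof.
move=> conG w0 wA nA; set y := map_mx _ w in nA.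
have wN0 i : w 0 i != 0.
  apply: contra_neq w0 => wi; have y00 : y = 0.
    apply: (nonneg_eigenvector_eq0 (k := i) conG _ nA).
      by move=> j; rewrite mxE.
    by rewrite mxE wi normr0.
  by apply/rowP=> j; have /rowP/(_ j)/eqP := y00; rewrite !mxE normr_eq0 => /eqP.
exists (fun v => 0 < w 0 (enum_rank v)) => u v uv.
(* The eigenvector equations of [w] and [|w|] at [u] have to match term by term. *)
set wu := w 0 (enum_rank u); set wv := w 0 (enum_rank v).
have wuv : `|wv| + Num.sg wu * wv = 0.
  (* The sum equals [s |wu| - s |wu|], and its terms are nonnegative because [|w_i|] dominates
     [- sg(wu) w_i]; so every term is 0. *)
  have : \sum_i ((y 0 i + Num.sg wu * w 0 i) * A i (enum_rank u)) == 0.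
    under eq_bigr do rewrite mulrDl -mulrA.
    rewrite big_split /= -mulr_sumr.
    have /rowP/(_ (enum_rank u)) := wA; have /rowP/(_ (enum_rank u)) := nA.
    rewrite !mxE -/wu => -> ->.
    by rewrite mulNr mulrN mulrCA -normrEsg subrr.
  rewrite psumr_eq0 => [/allP/(_ (enum_rank v) (mem_index_enum _))|i _].
    by rewrite !mxE !enum_rankK adj_sym uv mulr1 => /eqP.
  rewrite mulr_ge0 ?adjmx_ge0 // mxE -lerBlDr sub0r.
  apply: le_trans (ler_norm _) _.
  by rewrite normrN normrM normr_sg wN0 mul1r.
have := wN0 (enum_rank u); have := wN0 (enum_rank v); rewrite -/wu -/wv.
case: (ltrgt0P wu) => // wu0 wv0 _; move: wuv.
  rewrite gtr0_sg // mul1r => /eqP; rewrite addr_eq0 => /eqP h.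
  by rewrite -leNgt -oppr_ge0 -h normr_ge0.
rewrite ltr0_sg // mulN1r => /eqP; rewrite subr_eq0 => /eqP <-.
by rewrite normr_gt0 wv0.
Qed.

Lemma bipartite_of_multiple_singular_value (s : R) : connected_graph G ->
  largest_singular_value A s -> (2 <= sing_mult A s)%N -> bipartite.
Proof.
move=> conG sP s2; have s0 := largest_singular_value_ge0 sP.
have bnd (y : 'rV[R]_#|G|) :
    (y *m A *m (y *m A)^T) 0 0 <= s ^+ 2 * (y *m y^T) 0 0.
  by rewrite -{1 2}adjmx_tr; apply: largest_singular_value_le.
have nA c (x : 'rV_#|G|) := norm_eigenvector (c := c) (x := x) adjmx_ge0 s0 bnd.
pose E := eigenspace (A^T *m A) (s ^+ 2).
have rE : (2 <= \rank E)%N.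
  apply: leq_trans (eig_mult_eigenspace (gram_sym A) _).
  by move: s2; rewrite /sing_mult s0.
have [EA|/row_subPn[i vA]] := boolP (E <= eigenspace A s)%MS; last first.
  (* As [v (A^2 - s^2) = 0], the vector [w = v (A - s)], nonzero by the choice of [v], is killed by
     [A + s]. *)
  set v := row i E in vA; pose w := v *m A - s *: v.
  have /eigenspaceP : (v <= E)%MS by apply: row_sub.
  rewrite adjmx_tr mulmxA => vAA.
  have wA : w *m A = - s *: w.
    by rewrite mulmxBl vAA -scalemxAl scalerBr !scaleNr scalerA -expr2 opprK addrC.
  apply: (bipartite_of_opp_eigenvector conG _ wA).
    by apply: contra vA => w0; apply/eigenspaceP/eqP; rewrite -subr_eq0.
  by apply: nA wA; rewrite normrN ger0_norm.
have k : 'I_#|G| by apply: Ordinal conG.1.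
(* The row vectors with zero entry at [k]. Reading off that entry maps [E] to dimension at most 1,
   so by rank-nullity [E] meets [K] nontrivially. *)
pose K := kermx (delta_mx k 0 : 'cV[R]_#|G|).
have : (E :&: K)%MS != 0.
  rewrite -mxrank_eq0 -lt0n -(ltn_add2l (\rank (E *m delta_mx k (0 : 'I_1)))).
  rewrite mxrank_mul_ker addn0; apply: leq_ltn_trans rE.
  exact: rank_leq_col.
case/rowV0Pn=> x; rewrite sub_capmx => /andP[xE /sub_kermxP xK] x0.
have xA : x *m A = s *: x by apply/eigenspaceP/(submx_trans xE).
have xk : x 0 k = 0.
  by have := congr1 (fun z : 'M_1 => z 0 0) xK; rewrite -colE !mxE.
(* Here [A] acts as [s] on all of [E], and the zero of [x] at [k] forces [|x| = 0], which rules this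
   case out. *)
case/eqP: x0; apply/rowP=> j.
have /rowP/(_ j)/eqP : map_mx Num.norm x = 0.
  apply: (nonneg_eigenvector_eq0 (s := s) (k := k) conG).
  - by move=> i; rewrite mxE.
  - by apply: nA xA; rewrite ger0_norm.
  - by rewrite mxE xk normr0.
by rewrite !mxE normr_eq0 => /eqP.
Qed.

End AdjacencyMatrix.

Theorem theorem5p2 (R : realType) (G H : sgraph)
  (conG : connected_graph G) (conH : connected_graph H)
  (cosp : singularly_cospectral R G H)
  (multG : exists s : R, largest_singular_value (adjmx R G) s /\
     (2 <= sing_mult (adjmx R G) s)%N)
  (multH : exists s : R, largest_singular_value (adjmx R H) s /\
     (2 <= sing_mult (adjmx R H) s)%N) :
  almost_cospectral R G H.
Proof.
move=> a a0; have [s [sG s2]] := multG; have [t [tH t2]] := multH.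
have bG := bipartite_of_multiple_singular_value conG sG s2.
have bH := bipartite_of_multiple_singular_value conH tH t2.
have := cosp `|a|; rewrite normr_eq0 => /(_ a0).
rewrite !sing_mult_adjmx // !bipartite_eig_mult // !addnn.
exact: double_inj.
Qed.
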